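(* Let $d\ge 2$ be an integer and $\alpha\in\{1,4\}$ (i.e. the LRS ratio is $2$). Suppose there exists a $2$-distance set in $H_d$ that contains $R_d$ and whose two distances are $\sqrt{2}$ and $\sqrt{\alpha}$. Then $d\in\{7,8\}$, and if $X$ denotes a largest $2$-distance set in $H_d$ containing $R_d$ with distances $\sqrt2$ and $\sqrt\alpha$, then: (1) $|X|=12$ for $d=7$ and $\alpha=1$; (2) $|X|=24$ for $d=8$ and $\alpha=1$; (3) $|X|=29$ for $d=7$ and $\alpha=4$; (4) $|X|=45$ for $d=8$ and $\alpha=4$.
   Context: For an integer $d\ge 2$, let $H_d=\{(x_1,\dots,x_{d+1})\in\mathbb{R}^{d+1}:\sum_i x_i=1\}$ (isometric to $\mathbb{R}^d$) with the Euclidean distance, and let $R_d=\{\mathbf{e}_1,\dots,\mathbf{e}_{d+1}\}$ be the standard basis vectors of $\mathbb{R}^{d+1}$ (a $d$-dimensional regular simplex in $H_d$ with all distances $\sqrt2$). A finite set is a $2$-distance set if exactly two distinct distances occur between distinct points of it. For a $2$-distance set with distances $a<b$, the LRS ratio is the number $s$ with $a^2/b^2=(s-1)/s$; with distances $\sqrt2,\sqrt\alpha$, LRS ratio $2$ means $\alpha=1$ or $\alpha=4$. *)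

(* Defs.v *)
From HB Require Import structures.
From mathcomp Require Import all_boot all_order all_algebra.
From mathcomp Require Import finmap.
From mathcomp Require Import reals.

Set Implicit Arguments.
Unset Strict Implicit.
Unset Printing Implicit Defensive.

Import Order.TTheory GRing.Theory Num.Theory.
Local Open Scope fset_scope.
Local Open Scope ring_scope.

(* The library norm on matrices is the sup norm, hence this explicit
   Euclidean distance. *)
Definition edist (R : realType) (n : nat) (x y : 'rV[R]_n) : R :=
  Num.sqrt (\sum_(i < n) (x 0 i - y 0 i) ^+ 2).

Definition Hd (R : realType) (d : nat) : {pred 'rV[R]_d.+1} :=
  [pred x : 'rV[R]_d.+1 | \sum_(i < d.+1) x 0 i == 1].
Arguments Hd R d : clear implicits.

Definition Rd (R : realType) (d : nat) : {fset 'rV[R]_d.+1} :=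
  [fset delta_mx 0 i | i in 'I_d.+1].

Definition distances (R : realType) (n : nat) (X : {fset 'rV[R]_n}) : {fset R} :=
  [fset edist p.1 p.2 | p in X `*` X & p.1 != p.2].

Definition two_distance_set (R : realType) (n : nat) (X : {fset 'rV[R]_n}) : Prop :=
  #|` distances X| = 2%N.

Definition two_distance_ext (R : realType) (d : nat) (alpha : R)
    (X : {fset 'rV[R]_d.+1}) : Prop :=
  [/\ {subset X <= Hd R d},
      Rd R d `<=` X,
      two_distance_set X
    & distances X = [fset Num.sqrt 2; Num.sqrt alpha]].

Definition largest_two_distance_ext (R : realType) (d : nat) (alpha : R)
    (X : {fset 'rV[R]_d.+1}) : Prop :=
  two_distance_ext alpha X /\
  forall Y : {fset 'rV[R]_d.+1}, two_distance_ext alpha Y -> (#|` Y| <= #|` X|)%N.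

(* Main.v *)
Require Import Defs.
From HB Require Import structures.
From mathcomp Require Import all_boot all_order all_algebra.
From mathcomp Require Import finmap.
From mathcomp Require Import reals mxabelem.
From mathcomp Require Import ring lra zify.

Set Implicit Arguments.
Unset Strict Implicit.
Unset Printing Implicit Defensive.

Import Order.TTheory GRing.Theory Num.Theory.
Local Open Scope fset_scope.
Local Open Scope ring_scope.

(** Put n = d + 1.  A further point x of the set has only two coordinate values,
    since |x - e_i|^2 takes two values, so x is encoded by the set S of
    coordinates carrying the smaller one.  The distances to the e_i force
    n|S| = (|S| + 2)^2 if alpha = 1, and n(|S| - 1) = (|S| + 1)^2 if alpha = 4,
    whence n is 8 or 9; the distances between further points restrict the sizes
    of intersections.  What remains is four extremal problems:
    disjoint pairs in 8 points (at most 4);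
    4-sets in 9 points meeting in 0 or 2 points, plus possibly one singleton
    (at most 15, by isotropy in F_2^9);
    intersecting triples in 8 points (at most 21, by Katona's cycle argument);
    pairs and 5-sets in 9 points, where the complements of the 5-sets meet in at
    least two points and contain none of the pairs (at most 36, because
    2-intersecting 4-sets are no more numerous than the pairs they contain). *)

(** * Squared distances in the hyperplane and points with two coordinate values *)

Section Geometry.

Variables (R : realType) (d : nat).
Implicit Types (x y : 'rV[R]_d.+1) (S T : {set 'I_d.+1}).

Definition sqdist x y : R := \sum_i (x 0 i - y 0 i) ^+ 2.

(* The offset makes the coordinates sum to 1; the vertex e_i is the case
   delta = -1, S = {i}. *)
Definition pt (delta : R) S : 'rV[R]_d.+1 :=
  \row_i ((1 + #|S|%:R * delta) / d.+1%:R - (i \in S)%:R * delta).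

Lemma edistE x y : edist x y = Num.sqrt (sqdist x y).
Proof. by []. Qed.

Lemma sqdist_ge0 x y : 0 <= sqdist x y.
Proof. by apply: sumr_ge0 => i _; apply: sqr_ge0. Qed.

Lemma sqdistxx x : sqdist x x = 0.
Proof. by apply: big1 => i _; rewrite subrr expr0n. Qed.

Lemma sqdistC x y : sqdist x y = sqdist y x.
Proof. by apply: eq_bigr => i _; rewrite -sqrrN opprB. Qed.

Lemma sum_mem S : \sum_i (i \in S)%:R = #|S|%:R :> R.
Proof. by rewrite -natr_sum -sum1_card [in RHS]big_mkcond. Qed.

Lemma pt_in_Hd delta S : pt delta S \in Hd R d.
Proof.
apply/eqP; under eq_bigr do rewrite mxE.
rewrite sumrB sumr_const card_ord -mulr_suml sum_mem -[_ *+ d.+1]mulr_natr.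
by field; rewrite addrC natr1 pnatr_eq0.
Qed.

Lemma vertexE (i : 'I_d.+1) : delta_mx 0 i = pt (-1) [set i].
Proof.
apply/rowP => j; rewrite !mxE cards1 in_set1 mul1r subrr mul0r sub0r.
by rewrite mulrN1 opprK eqxx.
Qed.

(** The difference of the two points is the constant [b / N] minus [f], and [f] sums to [b];
    expanding the square, the constant and cross terms combine to [- b ^+ 2 / N]. *)
Lemma sqdist_pt delta eps S T :
  sqdist (pt delta S) (pt eps T) =
  delta ^+ 2 * #|S|%:R + eps ^+ 2 * #|T|%:R
  - 2 * delta * eps * #|S :&: T|%:R
  - (delta * #|S|%:R - eps * #|T|%:R) ^+ 2 / d.+1%:R.
Proof.
set N : R := d.+1%:R; have N0 : N != 0 by rewrite pnatr_eq0.
set b := (delta * #|S|%:R - eps * #|T|%:R).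
pose f i : R := delta * (i \in S)%:R - eps * (i \in T)%:R.
have sf : \sum_i f i = b by rewrite sumrB -!mulr_sumr !sum_mem.
have sf2 : \sum_i f i ^+ 2 = delta ^+ 2 * #|S|%:R + eps ^+ 2 * #|T|%:R
    - 2 * delta * eps * #|S :&: T|%:R.
  rewrite -!sum_mem !mulr_sumr -big_split -sumrB; apply: eq_bigr => i _.
  by rewrite /f inE; case: (i \in S); case: (i \in T) => /=; ring.
transitivity (\sum_(i < d.+1) (b / N) ^+ 2 - \sum_i 2 * (b / N) * f i
              + \sum_i f i ^+ 2).
  rewrite -sumrB -big_split; apply: eq_bigr => i _ /=.
  by rewrite !mxE /f /b -/N; move: N N0 => N N0; field.
rewrite -mulr_sumr sf sf2 sumr_const card_ord -[_ *+ d.+1]mulr_natr -/N.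
by move: N N0 => N N0; field.
Qed.

Lemma distancesP (X : {fset 'rV[R]_d.+1}) r :
  reflect (exists x y, [/\ x \in X, y \in X, x != y & r = edist x y])
          (r \in distances X).
Proof.
apply: (iffP idP) => [/imfsetP[[x y]]|[x [y [xX yX xy ->]]]].
  rewrite !inE /= => /andP[/andP[xX yX] xy] ->; by exists x, y.
by apply/imfsetP; exists (x, y) => //; rewrite !inE /= xX yX.
Qed.

Lemma RdP x : reflect (exists i, x = delta_mx 0 i) (x \in Rd R d).
Proof.
apply: (iffP idP) => [/imfsetP[i _ ->]|[i ->]]; first by exists i.
by apply/imfsetP; exists i.
Qed.

Lemma delta_mx_inj : injective (fun i : 'I_d.+1 => delta_mx 0 i : 'rV[R]_d.+1).
Proof.
move=> i j /rowP/(_ i); rewrite !mxE !eqxx /=.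
by case: eqP => //= _ /eqP; rewrite oner_eq0.
Qed.

Lemma card_Rd : #|` Rd R d| = d.+1.
Proof. by rewrite card_imfset ?size_enum_ord //; apply: delta_mx_inj. Qed.

Lemma sqdist_vertices (i j : 'I_d.+1) : i != j ->
  sqdist (delta_mx 0 i) (delta_mx 0 j) = 2.
Proof.
move=> ij; rewrite !vertexE sqdist_pt !cards1.
have -> : [set i] :&: [set j] = set0.
  by apply/setP => k; rewrite !inE; case: eqP => // ->; rewrite (negPf ij).
rewrite cards0; field.
by rewrite addrC natr1 pnatr_eq0.
Qed.

(** Removes the square roots. Two vertices already realise the distance [sqrt 2], so only [alpha]
    needs a witness; [alpha != 2] keeps the two distances distinct. *)
Lemma two_distance_extP (alpha : R) (X : {fset 'rV[R]_d.+1}) :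
    (0 < d)%N -> 0 <= alpha -> alpha != 2 ->
  two_distance_ext alpha X <->
  [/\ {subset X <= Hd R d}, Rd R d `<=` X,
      {in X &, forall x y, x != y -> sqdist x y = 2 \/ sqdist x y = alpha}
    & exists x y, [/\ x \in X, y \in X, x != y & sqdist x y = alpha]].
Proof.
move=> d0 a0 a2; have t0 : 0 <= 2 :> R by [].
have sqrtI (u v : R) : 0 <= u -> 0 <= v -> Num.sqrt u = Num.sqrt v -> u = v.
  by move=> u0 v0 e; rewrite -(sqr_sqrtr u0) e sqr_sqrtr.
split=> [[XH RX _ D]|[XH RX D [x [y [xX yX xy xya]]]]].
  split=> // [x y xX yX xy|].
    have : edist x y \in distances X by apply/distancesP; exists x, y.
    rewrite D !inE !edistE => /orP[] /eqP /sqrtI e; [left|right];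
      by apply: e => //; exact: sqdist_ge0.
  have : Num.sqrt alpha \in distances X by rewrite D !inE eqxx orbT.
  move=> /distancesP[x [y [xX yX xy e]]]; exists x, y; split=> //.
  by apply/esym/sqrtI => //; exact: sqdist_ge0.
have DE : distances X = [fset Num.sqrt 2; Num.sqrt alpha].
  apply/fsetP => r; rewrite !inE; apply/distancesP/orP.
    move=> [u [v [uX vX uv ->]]].
    by case: (D u v uX vX uv) => e; [left|right]; rewrite edistE e.
  move=> [] /eqP ->; last by exists x, y; rewrite edistE xya.
  pose i : 'I_d.+1 := ord0; pose j : 'I_d.+1 := ord_max.
  have ij : i != j by rewrite -val_eqE /=; case: (d) d0.
  exists (delta_mx 0 i), (delta_mx 0 j); split.
  - by apply: (fsubsetP RX); apply/RdP; exists i.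
  - by apply: (fsubsetP RX); apply/RdP; exists j.
  - by apply: contra ij => /eqP /delta_mx_inj ->.
  - by rewrite edistE sqdist_vertices.
split=> //; rewrite /two_distance_set DE cardfs2.
by case: eqP => // /sqrtI e; rewrite -e ?eqxx in a2.
Qed.

Lemma sqdist_vertex x (i : 'I_d.+1) :
  sqdist x (delta_mx 0 i) = \sum_j x 0 j ^+ 2 - 2 * x 0 i + 1.
Proof.
have e : \sum_j (2 * x 0 j * (j == i)%:R - (j == i)%:R) = 2 * x 0 i - 1.
  rewrite (bigD1 i) //= eqxx big1 ?addr0 ?mulr1 // => j /negPf ->.
  by rewrite mulr0 subr0.
suff -> : sqdist x (delta_mx 0 i) =
    \sum_j x 0 j ^+ 2 - \sum_j (2 * x 0 j * (j == i)%:R - (j == i)%:R).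
  by rewrite e; ring.
rewrite -sumrB; apply: eq_bigr => j _; rewrite !mxE /=.
by case: (j == i) => /=; ring.
Qed.

(* sqdist x e_i = |x|^2 + 1 - 2 x_i, so x has only two coordinate values, and
   the coordinate sum determines them. *)
Lemma two_level_point (lo delta : R) x : x \in Hd R d ->
    (forall i, sqdist x (delta_mx 0 i) = lo \/
               sqdist x (delta_mx 0 i) = lo + 2 * delta) ->
  x = pt delta [set i | sqdist x (delta_mx 0 i) != lo].
Proof.
move=> /eqP xH hx; set S := [set i | _].
(* The value that [sqdist_vertex] forces on [x 0 i] when the squared distance to [e_i] is [lo]. *)
pose K := (\sum_j x 0 j ^+ 2 + 1 - lo) / 2.
have xE i : x 0 i = K - (i \in S)%:R * delta.
  have := hx i; rewrite inE sqdist_vertex /K.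
  case: eqP => /= [<- _|ne []] // => [|e]; first by field.
  by lra.
apply/rowP => i; rewrite mxE xE; congr (_ - _).
move: xH; under eq_bigr do rewrite xE.
rewrite sumrB sumr_const card_ord -mulr_suml sum_mem -[_ *+ d.+1]mulr_natr => e.
have N0 : d.+1%:R != 0 :> R by rewrite pnatr_eq0.
by apply: (mulIf N0); rewrite divfK //; apply/eqP; rewrite -subr_eq e.
Qed.

End Geometry.

(** * Distance conditions as arithmetic on set sizes *)

(* Throughout, [h = 1] encodes [alpha = 4] and [h = 2] encodes [alpha = 1].
   For sets of sizes p and r meeting in a points, this says that h^2 times the
   squared distance of the points [pt h^-1 S] and [pt h^-1 T] is 4 or 2h^2;
   terms are moved across so that no subtraction occurs. *)
Definition separated (n h p r a : nat) : bool :=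
  (n * (p + r) + 2 * p * r \in
    [:: n * (2 * a + 4) + p ^ 2 + r ^ 2; n * (2 * a + 2 * h ^ 2) + p ^ 2 + r ^ 2])%N.

(** For [p = #|S|], this says that [pt h^-1 S] is at squared distance [3 - h] from the vertices
    outside [S], multiplied by [n h^2]. The last term stands for [n h^2 (2 - h)], which has the same
    value for [h = 1, 2]. *)
Definition size_eq (n h p : nat) : bool :=
  (n * p == (p + h) ^ 2 + n * (2 - h))%N.

Definition admissible (n h : nat) (F : {set {set 'I_n}}) : Prop :=
  [/\ F != set0, {in F, forall S : {set 'I_n}, size_eq n h #|S|}
    & {in F &, forall S T : {set 'I_n}, S != T ->
        separated n h #|S| #|T| #|S :&: T|}].

(** * Correspondence between two-distance extensions and admissible families *)

Section Encoding.

Variables (R : realType) (d h : nat).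
Hypothesis d_gt0 : (0 < d)%N.
Hypothesis h12 : h = 1%N \/ h = 2%N.
Let N : R := d.+1%:R.
Let alpha : R := 4 / h%:R ^+ 2.
Let delta : R := h%:R^-1.
Let lo : R := 3 - h%:R.
Implicit Types (S T : {set 'I_d.+1}).

Let N_neq0 : N != 0. Proof. by rewrite pnatr_eq0. Qed.

(** [lo] is the smaller of 2 and [alpha], and [2 * delta] is their gap; [alpha] is the larger one
    for [h = 1] and the smaller one for [h = 2]. *)
Lemma levels (r : R) : (r = 2 \/ r = alpha) <-> (r = lo \/ r = lo + 2 * delta).
Proof. by rewrite /alpha /lo /delta; case: h12 => ->; split; lra. Qed.

Lemma sqdist_pt_vertex S i : sqdist (pt delta S) (delta_mx 0 i) =
  1 + delta ^+ 2 * #|S|%:R - (1 + delta * #|S|%:R) ^+ 2 / N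
  + 2 * delta * (i \in S)%:R.
Proof.
rewrite vertexE sqdist_pt cards1 -/N.
have -> : #|S :&: [set i]| = (i \in S).
  rewrite setIC; case: (boolP (i \in S)) => iS.
    by rewrite (setIidPl _) ?sub1set // cards1.
  by apply/eqP; rewrite cards_eq0 setI_eq0 disjoints1.
by move: N N_neq0 => M M0; field.
Qed.

Lemma size_eqE S : size_eq d.+1 h #|S| <->
  1 + delta ^+ 2 * #|S|%:R - (1 + delta * #|S|%:R) ^+ 2 / N = lo.
Proof.
rewrite /size_eq -(eqr_nat R) natrD natrX !natrM natrD -/N /delta /lo.
move: N N_neq0 (#|S|%:R) => M M0 m.
case: h12 => ->; rewrite /subn /=.
all: split=> [/eqP e|e]; first by apply: (mulIf M0); rewrite mulrBl divfK //; lra.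
all: by apply/eqP; move/(congr1 ( *%R^~ M)): e; rewrite mulrBl divfK //; lra.
Qed.

Lemma separated_natr n p r a : separated n h p r a =
  let l := n%:R * (p%:R + r%:R) + 2 * p%:R * r%:R :> R in
  let m c : R := n%:R * (2 * a%:R + c) + p%:R ^+ 2 + r%:R ^+ 2 in
  (l == m 4) || (l == m (2 * h%:R ^+ 2)).
Proof.
by rewrite /separated !inE -!(eqr_nat R) !(natrX, natrM, natrD).
Qed.

Lemma separatedE S T :
  separated d.+1 h #|S| #|T| #|S :&: T| <->
  sqdist (pt delta S) (pt delta T) = 2 \/ sqdist (pt delta S) (pt delta T) = alpha.
Proof.
rewrite sqdist_pt separated_natr -/N /alpha /delta.
move: N N_neq0 (#|S|%:R) (#|T|%:R) (#|S :&: T|%:R) => M M0 m r a.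
have eqM (u v w : R) : u - v / M = w <-> u * M - v = w * M.
  split=> [<-|e]; first by rewrite mulrBl divfK.
  by apply: (mulIf M0); rewrite mulrBl divfK.
rewrite !eqM.
split=> [/orP[] /eqP e|[] e].
- by right; case: h12 e => -> e; lra.
- by left; case: h12 e => -> e; lra.
- by apply/orP; right; apply/eqP; case: h12 e => -> e; lra.
- by apply/orP; left; apply/eqP; case: h12 e => -> e; lra.
Qed.

Lemma alpha_ge0 : 0 <= alpha.
Proof. by rewrite /alpha; case: h12 => ->; lra. Qed.

Lemma alpha_neq2 : alpha != 2.
Proof. by apply/eqP; rewrite /alpha; case: h12 => ->; lra. Qed.

Lemma delta_gt0 : 0 < delta.
Proof. by rewrite /delta; case: h12 => ->; lra. Qed.

(** Provides a vertex at squared distance [alpha] from [pt delta S]: it is indexed inside [S] if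
    [h = 1] and outside [S] if [h = 2]. *)
Lemma size_eq_bounds (S : {set 'I_d.+1}) :
  size_eq d.+1 h #|S| -> (2 - h < #|S| < d.+1)%N.
Proof.
move: (max_card S); rewrite card_ord /size_eq.
move: #|S| => m mn /eqP e.
by case: h12 e => ->; nia.
Qed.

Lemma two_distance_ext_encode (X : {fset 'rV[R]_d.+1}) :
  two_distance_ext alpha X ->
  exists2 F : {set {set 'I_d.+1}}, admissible h F & #|` X| = (d.+1 + #|F|)%N.
Proof.
move/(two_distance_extP _ d_gt0 alpha_ge0 alpha_neq2) => [XH RX D E].
pose far (x : 'rV[R]_d.+1) := [set i : 'I_d.+1 | sqdist x (delta_mx 0 i) != lo].
pose Y := X `\` Rd R d.
have vX i : delta_mx 0 i \in X by apply: (fsubsetP RX); apply/RdP; exists i.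
have YX x : x \in Y -> x \in X by rewrite in_fsetD => /andP[].
have Yv x i : x \in Y -> sqdist x (delta_mx 0 i) = lo \/
                         sqdist x (delta_mx 0 i) = lo + 2 * delta.
  rewrite in_fsetD => /andP[xR xX]; apply/levels; apply: D => //.
  by apply: contra xR => /eqP ->; apply/RdP; exists i.
have YE x : x \in Y -> x = pt delta (far x).
  by move=> xY; apply: two_level_point => [|i]; [apply/XH/YX|apply: Yv].
have farI : {in Y &, injective far}.
  by move=> x y xY yY e; rewrite (YE x xY) (YE y yY) e.
pose A := [fset far x | x in Y].
have cA : #|` A| = #|` Y| by rewrite card_in_imfset.
exists [set S in A]; last first.
  rewrite cardsE (card_uniqP (fset_uniq A)) -/(#|` A|) cA.
  by rewrite -(cardfsID (Rd R d) X) (fsetIidPr RX) card_Rd.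
split.
(* Two vertices are at squared distance 2, not [alpha], so a pair realising [alpha] contains a
   further point. *)
- case: E => x [y [xX yX xy e]].
  have [z zY] : exists z, z \in Y.
    have [/RdP[i xi]|xR] := boolP (x \in Rd R d); last first.
      by exists x; rewrite in_fsetD xR.
    have [/RdP[j yj]|yR] := boolP (y \in Rd R d); last first.
      by exists y; rewrite in_fsetD yR.
    have := alpha_neq2; rewrite -e xi yj sqdist_vertices ?eqxx //.
    by apply: contra xy => /eqP ij; rewrite xi yj ij.
  by apply/set0Pn; exists (far z); rewrite inE; apply/imfsetP; exists z.
- move=> S; rewrite inE => /imfsetP[x /= xY ->].
  (* One vertex suffices: membership of [ord0] in [far x] tells which of the two values occurs, and
     removing the indicator term leaves the size equation. *)
  apply/size_eqE; have := Yv x ord0 xY; have := delta_gt0.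
  have e : sqdist x (delta_mx 0 ord0) = sqdist (pt delta (far x)) (delta_mx 0 ord0).
    by rewrite {1}(YE x xY).
  have i0 : (ord0 \in far x) = (sqdist x (delta_mx 0 ord0) != lo) by rewrite inE.
  move: i0; rewrite e sqdist_pt_vertex.
  case: (ord0 \in far x) => /= /esym e1 d0.
    by move/eqP: e1 => e1 [/e1 //|]; rewrite mulr1 => /addIr.
  by move/negbFE/eqP: e1 => e1 _; rewrite -e1 mulr0 addr0.
- move=> S T; rewrite !inE => /imfsetP[x /= xY ->] /imfsetP[y /= yY ->] xy.
  apply/separatedE; rewrite -!YE //; apply: D; rewrite ?YX //.
  by apply: contra xy => /eqP ->.
Qed.

Lemma two_distance_ext_decode (F : {set {set 'I_d.+1}}) : admissible h F ->
  exists2 X : {fset 'rV[R]_d.+1}, two_distance_ext alpha X &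
    #|` X| = (d.+1 + #|F|)%N.
Proof.
move=> [F0 Fs Fsep].
have Fv S i : S \in F -> sqdist (pt delta S) (delta_mx 0 i) =
    lo + 2 * delta * (i \in S)%:R.
  by move=> /Fs/size_eqE e; rewrite sqdist_pt_vertex e.
have Fv2 S i : S \in F -> sqdist (pt delta S) (delta_mx 0 i) = 2 \/
    sqdist (pt delta S) (delta_mx 0 i) = alpha.
  move=> SF; apply/levels; rewrite Fv //.
  by case: (i \in S); rewrite ?mulr1 ?mulr0 ?addr0; [right|left].
have a0 : alpha != 0 by rewrite /alpha; case: h12 => ->; apply/eqP; lra.
(* As both distances are nonzero, the new points are distinct from each other and from the vertices,
   which makes the count exact. *)
have nz x y : sqdist x y = 2 \/ sqdist x y = alpha -> x != y :> 'rV[R]_d.+1.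
  move=> h2; apply/eqP => e; move: h2; rewrite e sqdistxx => -[] /eqP.
    by rewrite eq_sym pnatr_eq0.
  by rewrite eq_sym (negPf a0).
pose Y := [fset pt delta S | S in F].
have ptI : {in F &, injective (pt delta)}.
  move=> S T SF TF e; apply/eqP/negPn/negP => /(Fsep _ _ SF TF)/separatedE.
  by move=> /nz; rewrite e eqxx.
have RY : [disjoint Rd R d & Y]%fset.
  apply/fdisjointP => x /RdP[i ->]; apply/negP => /imfsetP[S /= SF e].
  by move: (nz _ _ (Fv2 S i SF)); rewrite e eqxx.
exists (Rd R d `|` Y); last first.
  have /eqP RY0 : Rd R d `&` Y == fset0 by exact: RY.
  by rewrite cardfsU RY0 cardfs0 subn0 card_Rd card_in_imfset //= cardE.
apply/(two_distance_extP _ d_gt0 alpha_ge0 alpha_neq2); split.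
- move=> x; rewrite in_fsetU => /orP[/RdP[i ->]|/imfsetP[S _ ->]];
    by rewrite ?vertexE pt_in_Hd.
- exact: fsubsetUl.
- move=> x y; rewrite !in_fsetU.
  move=> /orP[/RdP[i ->]|/imfsetP[S /= SF ->]] /orP[
    /RdP[j ->]|/imfsetP[T /= TF ->]] xy.
  + by left; apply: sqdist_vertices; apply: contra xy => /eqP ->.
  + by rewrite sqdistC; apply: Fv2.
  + exact: Fv2.
  + by apply/separatedE/Fsep => //; apply: contra xy => /eqP ->.
- have /set0Pn[S SF] := F0; have /andP[S0 Sn] := size_eq_bounds (Fs S SF).
  have [i ai] : exists i, sqdist (pt delta S) (delta_mx 0 i) = alpha.
    case: h12 => hh.
      have /card_gt0P[i iS] : (0 < #|S|)%N by apply: leq_ltn_trans S0.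
      by exists i; rewrite Fv // iS mulr1 /lo /delta /alpha hh; lra.
    have /card_gt0P[i iS] : (0 < #|~: S|)%N.
      by rewrite cardsCs setCK card_ord subn_gt0.
    exists i; rewrite Fv //; move: iS; rewrite inE => /negPf ->.
    by rewrite mulr0 /lo /delta /alpha hh; lra.
  exists (pt delta S), (delta_mx 0 i); split=> //.
  + by rewrite in_fsetU; apply/orP; right; apply/imfsetP; exists S.
  + by rewrite in_fsetU; apply/orP; left; apply/RdP; exists i.
  + by apply: nz; right.
Qed.

End Encoding.

(** * Rank bounds for set families *)

Section LinearAlgebraBounds.

(** A product of an [#|A|] by [#|B|] matrix with one of the transposed format can be the identity
    only if [#|A| <= #|B|]. *)
Lemma leq_card_biorthogonal (K : fieldType) (T U : finType)
    (A : {set T}) (B : {set U}) (f g : T -> U -> K) :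
    {in A &, forall t t', \sum_(u in B) f t u * g t' u = (t == t')%:R} ->
  (#|A| <= #|B|)%N.
Proof.
move=> fg.
pose M : 'M[K]_(#|A|, #|B|) := \matrix_(i, j) f (enum_val i) (enum_val j).
pose M' : 'M[K]_(#|B|, #|A|) := \matrix_(j, i) g (enum_val i) (enum_val j).
apply: (mulmx1_min (A := M) (B := M')); apply/matrixP => i k.
rewrite !mxE -(inj_eq enum_val_inj) -(fg _ _ (enum_valP i) (enum_valP k)).
rewrite [RHS]big_enum_val; apply: eq_bigr => j _; by rewrite !mxE.
Qed.

(** With the vectors of [G] as rows of [A], [A *m A^T = 0] gives twice the rank at most [n], and the
    row space over ['F_2] has 2 to the rank elements. *)
Lemma card_isotropic (n : nat) (G : {set 'rV['F_2]_n}) :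
  {in G &, forall u v, u *m v^T = 0} -> (#|G| <= 2 ^ n./2)%N.
Proof.
move=> G0; pose A : 'M['F_2]_(#|G|, n) := \matrix_i enum_val i.
have AA : A *m A^T = 0.
  apply/matrixP => i j; rewrite !mxE.
  have /matrixP/(_ 0 0) := G0 _ _ (enum_valP i) (enum_valP j).
  by rewrite !mxE => e; rewrite -[RHS]e; apply: eq_bigr => k _; rewrite !mxE.
have rA : (\rank A <= n./2)%N.
  by have := mulmx0_rank_max AA; rewrite mxrank_tr; lia.
have : G \subset rowg A.
  apply/subsetP => u uG; rewrite inE.
  have -> : u = row (enum_rank_in uG u) A by rewrite rowK enum_rankK_in.
  exact: row_sub.
move/subset_leq_card; rewrite card_rowg card_Fp // => /leq_trans; apply.
by rewrite leq_exp2l.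
Qed.

(** The scalar product of indicator vectors over ['F_2] is the parity of the intersection; the case
    [S = T] makes each vector orthogonal to itself. *)
Lemma card_even_meets (n : nat) (F : {set {set 'I_n}}) :
    {in F &, forall S T : {set 'I_n}, ~~ odd #|S :&: T|} ->
  (#|F| <= 2 ^ n./2)%N.
Proof.
move=> Fev; pose ind (S : {set 'I_n}) : 'rV['F_2]_n := \row_i (i \in S)%:R.
have indI : injective ind.
  move=> S T /rowP e; apply/setP => i; have := e i; rewrite !mxE.
  by case: (i \in S); case: (i \in T).
rewrite -(card_imset _ indI); apply: card_isotropic.
move=> _ _ /imsetP[S SF ->] /imsetP[T TF ->].
apply/matrixP => i j; rewrite !mxE.
transitivity (#|S :&: T|%:R : 'F_2).
  rewrite -sum1_card natr_sum [RHS]big_mkcond /=; apply: eq_bigr => k _.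
  by rewrite !mxE inE; case: (k \in S); case: (k \in T);
    rewrite /= ?mulr0 ?mul0r ?mulr1.
by rewrite -(odd_double_half #|_|) (negPf (Fev S T SF TF)) add0n
  -muln2 natrM pchar_Zp // mulr0.
Qed.

End LinearAlgebraBounds.

(** * Pairs contained in 2-intersecting 4-sets *)

Section Shadow.

Variables (T : finType).
Implicit Types (A : {set {set T}}) (P W : {set T}).

Definition pair_shadow A : {set {set T}} :=
  [set P : {set T} | #|P| == 2%N & [exists W in A, P \subset W]].

(* [g] is chosen so that the sum of [g W' P] over the pairs P of W is
   (s - 2)(s - 3) / 2 with s = #|W :&: W'|, which vanishes for s = 2, 3. *)
Lemma card_pair_shadow A :
    {in A, forall W : {set T}, #|W| = 4%N} ->
    {in A &, forall W W' : {set T}, (2 <= #|W :&: W'|)%N} ->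
  (#|A| <= #|pair_shadow A|)%N.
Proof.
move=> A4 A2; pose f W P : rat := (P \subset W)%:R.
pose g W P : rat := (P \subset W)%:R / 3 + 2 * (P \subset ~: W)%:R / 3 - 1 / 6.
apply: (leq_card_biorthogonal (f := f) (g := g)) => W W' WA WA'.
have pairs (V : {set T}) :
    \sum_(P : {set T} | #|P| == 2%N) ((P \subset V)%:R : rat) = 'C(#|V|, 2)%:R.
  rewrite -natr_sum -cards_draws -sum1_card; congr _%:R.
  rewrite big_mkcond [RHS]big_mkcond /=; apply: eq_bigr => P _.
  by rewrite inE andbC; case: (_ == _) => //=; case: (_ \subset _).
(* Summing over all pairs adds nothing, since [f W] vanishes on pairs outside the shadow. *)
transitivity (\sum_(P : {set T} | #|P| == 2%N) f W P * g W' P).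
  rewrite big_mkcond [RHS]big_mkcond; apply: eq_bigr => P _ /=; rewrite inE.
  case: eqP => //= _; case: existsP => //= nW.
  rewrite /f; case: (boolP (P \subset W)) => PW; last by rewrite mul0r.
  by case: nW; exists W; rewrite WA.
transitivity ('C(#|W :&: W'|, 2)%:R / 3 + 2 * 'C(#|W :\: W'|, 2)%:R / 3
              - 'C(#|W|, 2)%:R / 6 : rat).
  rewrite -!pairs !mulr_sumr !mulr_suml -big_split -sumrB; apply: eq_bigr => P _.
  rewrite /f /g subsetI subsetD disjoints_subset /=.
  by case: (P \subset W); case: (P \subset W'); case: (P \subset ~: W') => /=; lra.
have := cardsID W' W; have := A2 _ _ WA WA'.
have [<-|ne] := eqVneq W W'.
  by rewrite setIid setDv cards0 A4.
have : (#|W :&: W'| < 4)%N.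
  rewrite -(A4 W WA) ltn_neqAle subset_leq_card ?subsetIl // andbT.
  apply: contra ne => /eqP e.
  have WW' : W \subset W' by apply/setIidPl/eqP; rewrite eqEcard subsetIl e leqnn.
  by rewrite eqEcard WW' !A4.
rewrite (A4 W WA); move: #|_ :&: _| #|_ :\: _| => s t s4 s2 st.
by have [[-> ->]|[-> ->]] : (s = 2 /\ t = 2)%N \/ (s = 3 /\ t = 1)%N by lia.
Qed.

End Shadow.

(** * Explicit families, checked by computation *)

Section ListedSets.

Variable n : nat.
Implicit Types (l : seq nat) (L : seq (seq nat)).

Definition setl l : {set 'I_n} := [set i : 'I_n | val i \in l].

Definition wf_seq l := uniq l && all (fun x => x < n)%N l.

Lemma card_setl l : wf_seq l -> #|setl l| = size l.
Proof.
move=> /andP[ul /allP ln]; rewrite cardE -(size_map val).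
apply/perm_size/uniq_perm => //.
  by rewrite map_inj_uniq ?enum_uniq //; apply: val_inj.
move=> x; apply/mapP/idP => [[i]|xl]; first by rewrite mem_enum inE => il ->.
by exists (Ordinal (ln x xl)); rewrite // mem_enum inE.
Qed.

Lemma setlI l l' : setl l :&: setl l' = setl [seq x <- l | x \in l'].
Proof. by apply/setP => i; rewrite !inE mem_filter andbC. Qed.

Lemma card_setlI l l' : wf_seq l -> #|setl l :&: setl l'| = count (mem l') l.
Proof.
move=> /andP[ul ln]; rewrite setlI card_setl -?size_filter //.
rewrite /wf_seq filter_uniq //=; apply/allP => x.
by rewrite mem_filter => /andP[_ /(allP ln)].
Qed.

Definition listed L : {set {set 'I_n}} := [set S in map setl L].

Lemma listedP L S : reflect (exists2 l, l \in L & S = setl l) (S \in listed L).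
Proof. by rewrite inE; apply: mapP. Qed.

(** A common element count below the size of one list shows that the two sets differ; this is a
    computable test, insensitive to the order of elements. *)
Lemma setl_inj_in L : all wf_seq L ->
    all (fun l => all (fun l' => (l == l') || (count (mem l') l < size l)%N) L) L ->
  {in L &, injective setl}.
Proof.
move=> /allP Lw /allP LL l l' lL lL' e.
have /allP/(_ l' lL')/orP[/eqP //|] := LL l lL.
by rewrite -card_setlI ?Lw // -e setIid card_setl ?Lw // ltnn.
Qed.

Lemma card_listed L : {in L &, injective setl} -> uniq L -> #|listed L| = size L.
Proof.
move=> inj uL; rewrite cardsE -(size_map setl).
by apply/card_uniqP; rewrite map_inj_in_uniq.
Qed.

Definition listed_check h L : bool :=
  [&& L != [::], uniq L, all wf_seq L, all (fun l => size_eq n h (size l)) L &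
      all (fun l => all (fun l' => (l == l') ||
        [&& (count (mem l') l < size l)%N
          & separated n h (size l) (size l') (count (mem l') l)]) L) L].

Lemma listed_admissible h L : listed_check h L ->
  admissible h (listed L) /\ #|listed L| = size L.
Proof.
move=> /and5P[L0 uL Lw /allP Ls /allP LL].
have inj : {in L &, injective setl}.
  apply: setl_inj_in => //; apply/allP => l /LL /allP lL; apply/allP => l' /lL.
  by case: eqP => //= _ /andP[].
split; last exact: card_listed.
move/allP in Lw; split.
- case: L L0 {uL Lw Ls LL inj} => // l L _; apply/set0Pn.
  by exists (setl l); apply/listedP; exists l; rewrite ?mem_head.
- by move=> _ /listedP[l lL ->]; rewrite card_setl ?Lw ?Ls.
- move=> _ _ /listedP[l lL ->] /listedP[l' lL' ->] ne.
  rewrite card_setlI ?card_setl ?Lw //.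
  have /allP/(_ l' lL')/orP[/eqP e|/andP[] //] := LL l lL.
  by rewrite e eqxx in ne.
Qed.

End ListedSets.

(** * Intersecting triples in 8 points *)

Section ErdosKoRado83.

(* Seven cyclic orders of 8 points whose 56 arcs of length 3 are all the
   triples, each exactly once (found by computer search). *)
Definition cycles : seq (seq nat) :=
  [:: [:: 0; 1; 2; 3; 4; 5; 6; 7]; [:: 0; 1; 3; 4; 6; 2; 7; 5];
      [:: 0; 2; 3; 5; 1; 6; 7; 4]; [:: 0; 2; 5; 4; 1; 6; 3; 7];
      [:: 0; 1; 4; 2; 7; 3; 5; 6]; [:: 0; 3; 6; 2; 1; 7; 4; 5];
      [:: 0; 4; 3; 7; 1; 5; 2; 6]]%N.

Definition arc (c : seq nat) (j : nat) : seq nat :=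
  [seq nth 0%N c ((j + k) %% 8)%N | k <- iota 0 3].

Definition arcs (c : seq nat) : seq (seq nat) := [seq arc c j | j <- iota 0 8].

(** The 56 arcs give distinct triples, and there are only ['C(8, 3) = 56] triples. *)
Lemma triples_of_arcs (S : {set 'I_8}) :
  #|S| = 3%N -> S \in listed 8 (flatten (map arcs cycles)).
Proof.
set L := flatten _ => S3.
have Lw : all (wf_seq 8) L by vm_compute.
have inj : {in L &, injective (@setl 8)} by apply: setl_inj_in => //; vm_compute.
have cL : #|listed 8 L| = 56%N by rewrite card_listed //; vm_compute.
suff -> : listed 8 L = [set S : {set 'I_8} | #|S| == 3%N] by rewrite inE S3.
apply/eqP; rewrite eqEcard cL card_draws card_ord andbT.
apply/subsetP => _ /listedP[l lL ->]; rewrite inE card_setl ?(allP Lw) //.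
by apply: (allP (_ : all (fun l => size l == 3%N) L)) lL; vm_compute.
Qed.

(** [b j] is meant to say that the arc starting at position [j] is in the family; arcs of length 3
    in a cycle of 8 are disjoint exactly when their starts differ by 3, 4 or 5 modulo 8. *)
Lemma independent_arcs (b : nat -> bool) :
    (forall j k, (j < 8)%N -> (k < 8)%N ->
      (3 <= (k + 8 - j) %% 8 <= 5)%N -> ~~ (b j && b k)) ->
  (count b (iota 0 8) <= 3)%N.
Proof.
move=> bb /=.
(* The twelve disjoint pairs of arcs, followed by a case check over all choices of [b]. *)
have := (bb 0 3 isT isT isT, bb 0 4 isT isT isT, bb 0 5 isT isT isT)%N.
have := (bb 1 4 isT isT isT, bb 1 5 isT isT isT, bb 1 6 isT isT isT)%N.
have := (bb 2 5 isT isT isT, bb 2 6 isT isT isT, bb 2 7 isT isT isT)%N.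
have := (bb 3 6 isT isT isT, bb 3 7 isT isT isT, bb 4 7 isT isT isT)%N.
move: (b 0) (b 1) (b 2) (b 3) (b 4) (b 5) (b 6) (b 7) => b0 b1 b2 b3 b4 b5 b6 b7.
by case: b0; case: b1; case: b2; case: b3; case: b4; case: b5; case: b6;
  case: b7 => //=; do 4?[move=> [[? ?] ?] //].
Qed.

(** Every triple is an arc of one of the seven cycles, and each cycle has at most three pairwise
    intersecting arcs: 7 times 3 is 21. *)
Lemma card_intersecting_triples (F : {set {set 'I_8}}) :
    {in F, forall S : {set 'I_8}, #|S| = 3%N} ->
    {in F &, forall S T : {set 'I_8}, S :&: T != set0} ->
  (#|F| <= 21)%N.
Proof.
move=> F3 FI; pose b l := setl 8 l \in F.
have {F3} FL : (#|F| <= count b (flatten (map arcs cycles)))%N.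
  rewrite -(count_map (setl 8) (mem F)) -size_filter.
  apply: leq_trans (card_size _); apply/subset_leq_card/subsetP => S SF.
  rewrite mem_filter /= SF /=.
  by have := triples_of_arcs (F3 S SF); rewrite inE.
apply: leq_trans FL _; rewrite count_flatten -map_comp.
have arcs3 c : c \in cycles -> (count b (arcs c) <= 3)%N.
  move=> cC; rewrite count_map; apply: independent_arcs => j k j8 k8 jk.
  have dis : ~~ has (mem (arc c k)) (arc c j).
    have : all (fun c => all (fun j => all (fun k =>
        (3 <= (k + 8 - j) %% 8 <= 5)%N ==> ~~ has (mem (arc c k)) (arc c j))
      (iota 0 8)) (iota 0 8)) cycles by vm_compute.
    move/allP/(_ c cC)/allP/(_ j); rewrite mem_iota => /(_ j8)/allP/(_ k).
    by rewrite mem_iota => /(_ k8)/implyP/(_ jk).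
  apply/negP => /andP[/= Fj Fk]; have /negP[] := FI _ _ Fj Fk.
  rewrite setlI; have /eqP -> : [seq x <- arc c j | x \in arc c k] == [::].
    by rewrite -size_eq0 size_filter -leqn0 leqNgt -has_count.
  by apply/eqP/setP => i; rewrite !inE.
rewrite (_ : 21 = sumn (map (fun=> 3) cycles))%N //.
elim: cycles arcs3 => //= c C IH h3; apply: leq_add.
  by apply: h3; rewrite mem_head.
by apply: IH => c' cC; apply: h3; rewrite inE cC orbT.
Qed.

End ErdosKoRado83.

(** * Possible sizes and upper bounds for admissible families *)

Section AdmissibleBounds.

(** Expanding gives [j * (n - j - 4) = 4], so [j] divides 4. *)
Lemma nat_square_quotient n j : (n * j = (j + 2) ^ 2)%N ->
  [\/ n = 9 /\ j = 1, n = 8 /\ j = 2 | n = 9 /\ j = 4]%N.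
Proof.
move=> e; have j0 : (0 < j)%N by case: j e => //; rewrite muln0.
have j4 : (j * (n - j - 4) = 4)%N by nia.
have jle : (j <= 4)%N by nia.
by case: j jle j0 e {j4} => [|[|[|[|[|j]]]]] //= _ _ e;
  [constructor 1|constructor 2|exfalso|constructor 3]; lia.
Qed.

Lemma size_eq2 n p : size_eq n 2 p ->
  [\/ n = 9 /\ p = 1, n = 8 /\ p = 2 | n = 9 /\ p = 4]%N.
Proof. by move=> /eqP e; apply: nat_square_quotient; rewrite e; lia. Qed.

(** The equation reads [n (p - 1) = (p + 1)^2], the previous one with [j = p - 1]. *)
Lemma size_eq1 n p : size_eq n 1 p ->
  [\/ n = 9 /\ p = 2, n = 8 /\ p = 3 | n = 9 /\ p = 5]%N.
Proof.
move=> /eqP e; have p0 : (0 < p)%N by case: p e => //; nia.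
have /nat_square_quotient : (n * p.-1 = (p.-1 + 2) ^ 2)%N by nia.
by case=> -[? ?]; [constructor 1|constructor 2|constructor 3]; lia.
Qed.

Lemma admissible_bound_7_1 (F : {set {set 'I_8}}) : admissible 2 F -> (#|F| <= 4)%N.
Proof.
move=> [_ Fs Fd].
have F2 S : S \in F -> #|S| = 2%N by move/Fs/size_eq2 => [] [].
have tF : trivIset F.
  apply/trivIsetP => S T SF TF /(Fd _ _ SF TF).
  rewrite (F2 S) // (F2 T) // -setI_eq0 -cards_eq0 /separated !inE.
  by move=> /orP[] /eqP; lia.
have : (#|cover F| <= 8)%N by apply: leq_trans (max_card _) _; rewrite card_ord.
(* This is [tF] unfolded. *)
have /eqP <- : (\sum_(S in F) #|S| == #|cover F|)%N by [].
by rewrite (eq_bigr (fun=> 2%N)) // sum_nat_const; lia.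
Qed.

(* A singleton {i} is replaced by its complement, of size 8, so that all sets
   of the family, together with the empty set, meet evenly. *)
Lemma admissible_bound_8_1 (F : {set {set 'I_9}}) : admissible 2 F -> (#|F| <= 15)%N.
Proof.
move=> [_ Fs Fd].
have F14 S : S \in F -> #|S| = 1%N \/ #|S| = 4%N.
  by move/Fs/size_eq2 => [[_ ->]|[]|[_ ->]] //; [left|right].
pose g (S : {set 'I_9}) := if #|S| == 1%N then ~: S else S.
have cC (S : {set 'I_9}) : #|~: S| = (9 - #|S|)%N by rewrite cardsCs setCK card_ord.
have cg S : S \in F -> #|g S| = (if #|S| == 1%N then 8 else 4)%N.
  by rewrite /g => /F14[] e; rewrite e /= ?cC e.
have gI : {in F &, injective g}.
  move=> S T SF TF; move: (cg S SF) (cg T TF); rewrite /g.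
  case: ifP; case: ifP => _ _ // cS cT e.
  - by apply: setC_inj.
  - by move: cS; rewrite e cT.
  - by move: cS; rewrite e cT.
have meet S T : S \in F -> T \in F -> ~~ odd #|g S :&: g T|.
  move=> SF TF; have [<-|ne] := eqVneq S T; first by rewrite setIid cg //; case: ifP.
  have ne' : T != S by rewrite eq_sym.
  (* Two singletons are never separated, and a singleton is separated from a 4-set only when
     disjoint from it, so its complement contains the 4-set. *)
  have D (U V : {set 'I_9}) : U \in F -> V \in F -> U != V ->
      #|U| = 1%N -> #|V| = 4%N /\ ~~ odd #|g U :&: g V|.
    move=> UF VF UV U1; have := Fd _ _ UF VF UV; rewrite U1.
    case: (F14 V VF) => V1; rewrite V1 /separated !inE.
      by move=> /orP[] /eqP; lia.
    move=> UV0; split=> //; rewrite /g U1 V1 /=.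
    have : (#|U :&: V| + #|~: U :&: V| = #|V|)%N.
      by rewrite setIC [~: U :&: V]setIC -setDE cardsID.
    rewrite V1 => e; suff -> : #|~: U :&: V| = 4%N by [].
    by move: UV0 => /orP[] /eqP; lia.
  case: (F14 S SF) => cS; first by have [_] := D S T SF TF ne cS.
  case: (F14 T TF) => cT; first by have [_] := D T S TF SF ne' cT; rewrite setIC.
  rewrite /g cS cT /=; have := Fd _ _ SF TF ne; rewrite cS cT /separated !inE.
  by move=> /orP[] /eqP e;
    [have -> : #|S :&: T| = 2%N by lia|have -> : #|S :&: T| = 0%N by lia].
have n0 : set0 \notin g @: F.
  apply/imsetP => -[S SF /esym/eqP]; rewrite -cards_eq0 cg //.
  by case: ifP.
rewrite -(card_in_imset gI).
(* Here 16 is [2 ^ 9./2]; the empty set takes one place. *)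
suff : (#|set0 |: g @: F| <= 16)%N by rewrite cardsU1 n0.
apply: (@card_even_meets 9) => S T; rewrite !inE.
move=> /orP[/eqP ->|/imsetP[S' SF ->]] /orP[/eqP ->|/imsetP[T' TF ->]];
  by rewrite ?set0I ?setI0 ?cards0 ?meet.
Qed.

(** Separated triples in 8 points meet in one or two points. *)
Lemma admissible_bound_7_4 (F : {set {set 'I_8}}) : admissible 1 F -> (#|F| <= 21)%N.
Proof.
move=> [_ Fs Fd].
have F3 S : S \in F -> #|S| = 3%N by move/Fs/size_eq1 => [] [].
apply: card_intersecting_triples => // S T SF TF.
have [<-|ne] := eqVneq S T; first by rewrite setIid -cards_eq0 F3.
have := Fd _ _ SF TF ne; rewrite (F3 S SF) (F3 T TF) -cards_eq0 /separated !inE.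
by move=> /orP[] /eqP; lia.
Qed.

Lemma admissible_bound_8_4 (F : {set {set 'I_9}}) : admissible 1 F -> (#|F| <= 36)%N.
Proof.
move=> [_ Fs Fd].
have F25 S : S \in F -> #|S| = 2%N \/ #|S| = 5%N.
  by move/Fs/size_eq1 => [[_ ->]|[]|[_ ->]] //; [left|right].
have cC (S : {set 'I_9}) : #|~: S| = (9 - #|S|)%N by rewrite cardsCs setCK card_ord.
pose F2 := [set S in F | #|S| == 2%N]; pose F5 := [set S in F | #|S| == 5%N].
pose A := [set ~: S | S in F5].
have cA : #|A| = #|F5| by rewrite card_imset //; exact: setC_inj.
have A4 : {in A, forall W : {set 'I_9}, #|W| = 4%N}.
  by move=> W /imsetP[S]; rewrite inE => /andP[_ /eqP S5] ->; rewrite cC S5.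
have A2 : {in A &, forall W W' : {set 'I_9}, (2 <= #|W :&: W'|)%N}.
  move=> _ _ /imsetP[S SF ->] /imsetP[T TF ->].
  move: SF TF; rewrite !inE => /andP[SF /eqP S5] /andP[TF /eqP T5].
  have [<-|ne] := eqVneq S T; first by rewrite setIid cC S5.
  rewrite -setCU cC cardsU S5 T5.
  (* Separated 5-sets meet in 3 or 4 points, so their complements meet in 2 or 3. *)
  by have := Fd _ _ SF TF ne; rewrite S5 T5 /separated !inE => /orP[] /eqP; lia.
have FE : F = F2 :|: F5.
  apply/setP => S; rewrite !inE -andb_orr; case: (boolP (S \in F)) => //= SF.
  by case: (F25 S SF) => ->.
have F2B : F2 :&: pair_shadow A = set0.
  apply/setP => P; rewrite !inE; apply/negP => /andP[/andP[PF /eqP P2]].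
  move=> /andP[_ /exists_inP[W /imsetP[S SF ->] PS]].
  move: SF; rewrite inE => /andP[SF /eqP S5].
  have ne : P != S by apply/eqP => e; move: P2; rewrite e S5.
  have := Fd _ _ PF SF ne; rewrite P2 S5.
  have -> : P :&: S = set0 by apply/eqP; rewrite setI_eq0 disjoints_subset.
  by rewrite cards0.
(* A separated pair and 5-set always meet, hence [F2] and the shadow are disjoint. Together they fit
   into the 36 pairs, and the shadow is at least as large as [F5]. *)
have sub : F2 :|: pair_shadow A \subset [set P : {set 'I_9} | #|P| == 2%N].
  by apply/subsetP => P; rewrite !inE => /orP[/andP[]|/andP[]].
have := subset_leq_card sub; rewrite card_draws card_ord cardsU F2B cards0 subn0.
have := card_pair_shadow A4 A2; rewrite cA.
have : (#|F| <= #|F2| + #|F5|)%N by rewrite {1}FE cardsU leq_subr.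
rewrite (_ : 'C(9, 2) = 36)%N //; lia.
Qed.

End AdmissibleBounds.

(** * Optimal families and conclusion *)

(* The 4-sets are the words of weight 4 of the extended Hamming [8,4,4] code. *)
Definition optimal_family (n h : nat) : seq (seq nat) :=
  if h == 1%N then
    if n == 8%N then [seq [:: 0%N; i; j] | j <- iota 1 7, i <- iota 1 j.-1]
    else [seq [:: i; j] | j <- iota 0 9, i <- iota 0 j]
  else
    if n == 8%N then [:: [:: 0; 1]; [:: 2; 3]; [:: 4; 5]; [:: 6; 7]]%N
    else [:: [:: 8]; [:: 0; 1; 2; 3]; [:: 0; 1; 4; 5]; [:: 0; 1; 6; 7];
             [:: 0; 2; 4; 6]; [:: 0; 2; 5; 7]; [:: 0; 3; 4; 7]; [:: 0; 3; 5; 6];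
             [:: 1; 2; 4; 7]; [:: 1; 2; 5; 6]; [:: 1; 3; 4; 6]; [:: 1; 3; 5; 7];
             [:: 2; 3; 4; 5]; [:: 2; 3; 6; 7]; [:: 4; 5; 6; 7]]%N.

(** The upper bounds equal the lengths of the listed families: 21 and 36 for [h = 1], 4 and 15 for
    [h = 2], with 8 and 9 points respectively. *)
Lemma admissible_max d h (F : {set {set 'I_d.+1}}) :
    h = 1%N \/ h = 2%N -> admissible h F ->
  [/\ d = 7%N \/ d = 8%N, (#|F| <= size (optimal_family d.+1 h))%N
    & listed_check d.+1 h (optimal_family d.+1 h)].
Proof.
move=> h12 FA; have [/set0Pn[S SF] Fs _] := FA.
have d78 : d = 7%N \/ d = 8%N.
  by case: h12 (Fs S SF) => -> => [/size_eq1|/size_eq2] [] [] [] *;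
    [right|left|right|right|left|right].
split=> //.
  by case: h12 d78 FA => -> [] e; subst d => FA;
    [apply: admissible_bound_7_4|apply: admissible_bound_8_4
    |apply: admissible_bound_7_1|apply: admissible_bound_8_1].
by case: h12 d78 => -> [] ->; vm_compute.
Qed.

Theorem theorem3p7 (R : realType) (d : nat) (alpha : R)
    (hd : (2 <= d)%N) (halpha : alpha = 1 \/ alpha = 4)
    (hex : exists X : {fset 'rV[R]_d.+1}, two_distance_ext alpha X) :
  [/\ d = 7%N \/ d = 8%N,
      exists X : {fset 'rV[R]_d.+1}, largest_two_distance_ext alpha X
    & forall X : {fset 'rV[R]_d.+1}, largest_two_distance_ext alpha X ->
      [/\ d = 7%N -> alpha = 1 -> #|` X| = 12%N,
          d = 8%N -> alpha = 1 -> #|` X| = 24%N,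
          d = 7%N -> alpha = 4 -> #|` X| = 29%N
        & d = 8%N -> alpha = 4 -> #|` X| = 45%N]].
Proof.
have d0 : (0 < d)%N by apply: leq_trans hd.
have [h h12 aE] : exists2 h : nat, h = 1%N \/ h = 2%N & alpha = 4 / h%:R ^+ 2.
  case: halpha => ->; first by exists 2%N; [right|lra].
  by exists 1%N; [left|lra].
have ub (Y : {fset 'rV[R]_d.+1}) : two_distance_ext alpha Y ->
  [/\ d = 7%N \/ d = 8%N,
    (#|` Y| <= d.+1 + size (optimal_family d.+1 h))%N
    & listed_check d.+1 h (optimal_family d.+1 h)].
  rewrite aE => YE; have [F FA ->] := two_distance_ext_encode d0 h12 YE.
  have [d78 Fle ch] := admissible_max h12 FA.
  by rewrite leq_add2l.
have [X0 /ub[d78 _ ch]] := hex.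
have [bA bc] := listed_admissible ch.
have [X1 X1e X1c] := two_distance_ext_decode R d0 h12 bA.
rewrite -aE bc in X1e X1c.
have lX1 : largest_two_distance_ext alpha X1.
  by split=> // Y /ub[_]; rewrite X1c.
split=> //; first by exists X1.
move=> X [Xe Xmax].
have {ch bA bc lX1 X0 hex} Xc : #|` X| = (d.+1 + size (optimal_family d.+1 h))%N.
  by apply/eqP; rewrite eqn_leq -{2}X1c Xmax // andbT; have [_] := ub X Xe.
(* The totals are 8 + 4, 9 + 15, 8 + 21 and 9 + 36; the value of [h] not matching [alpha] is
   contradictory. *)
split=> dE a; rewrite Xc dE; case: h12 aE => ->; rewrite a //= => e; exfalso; lra.
Qed.
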